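(* Let $X$ be a path connected, locally path connected topological space with base point $x_0$ and let $H$ be a normal subgroup of $\pi_1(X,x_0)$. Then $X$ is an $H$-SLT space if and only if $\tilde X^{wh}_{[\lambda^{-1}H\lambda]}=\tilde X^{top}_{[\lambda^{-1}H\lambda]}$ (i.e. the two topologies on the set $\tilde X_{[\lambda^{-1}H\lambda]}$ coincide) for every $x\in X$ and every path $\lambda$ in $X$ from $x_0$ to $x$.
   Context: $\ast$ denotes concatenation of paths and $\alpha^{-1}$ the reverse path. For $x\in X$, $P(X,x)$ is the space of paths in $X$ starting at $x$ with the compact-open topology. For a subgroup $G\le\pi_1(X,x)$ put, for $\alpha,\beta\in P(X,x)$, $\alpha\sim_G\beta$ iff $\alpha(1)=\beta(1)$ and $[\alpha\ast\beta^{-1}]\in G$; $[\alpha]_G$ is the class of $\alpha$ and $\tilde X_G$ the set of classes. $\tilde X_G^{top}$ is $\tilde X_G$ with the quotient topology from $P(X,x)$. $\tilde X_G^{wh}$ is $\tilde X_G$ with the whisker topology, with basis the sets $([\alpha]_G,U)=\{[\alpha\ast\beta]_G:\beta\text{ a path in }U\text{ with }\beta(0)=\alpha(1)\}$, where $\alpha\in P(X,x)$ and $U$ is an open neighborhood of $\alpha(1)$. For a path $\lambda$ from $x_0$ to $x$, $[\lambda^{-1}H\lambda]$ denotes the subgroup $\{[\lambda^{-1}\ast h\ast\lambda]:[h]\in H\}$ of $\pi_1(X,x)$. For $x\in X$ and $G\le\pi_1(X,x)$, $X$ is $G$-SLT at $x$ if for every path $\alpha$ in $X$ beginning at $x$ and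 every open set $U\ni x$ there is an open set $V\ni\alpha(1)$ such that for every loop $\beta$ in $V$ based at $\alpha(1)$ there is a loop $\gamma$ in $U$ based at $x$ with $[\alpha\ast\beta\ast\alpha^{-1}]_G=[\gamma]_G$. For $H\le\pi_1(X,x_0)$, $X$ is an $H$-SLT space if for every $x\in X$ and every path $\lambda$ from $x_0$ to $x$, $X$ is $[\lambda^{-1}H\lambda]$-SLT at $x$. *)

(* Defs.v *)
From HB Require Import structures.
From mathcomp Require Import all_boot all_order all_algebra.
From mathcomp Require Import generic_quotient.
From mathcomp Require Import all_classical all_reals topology normedtype.
From mathcomp Require Import homotopy.
From mathcomp Require Import lra.

Set Implicit Arguments.
Unset Strict Implicit.
Unset Printing Implicit Defensive.

Import Order.TTheory GRing.Theory Num.Theory.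
Import numFieldNormedType.Exports.

Local Open Scope classical_set_scope.
Local Open Scope ring_scope.
Local Open Scope quotient_scope.

Section unit_interval.
Context {R : realType}.

Definition unit_interval : Type := set_type `[(0 : R), 1]%classic.

HB.instance Definition _ := Topological.on unit_interval.

(* Nearest-point retraction of R onto [0, 1]; it is the identity on [0, 1]. *)
Definition clamp (x : R) : R := Num.max 0 (Num.min x 1).

Lemma clamp_subproof x : clamp x \in `[(0 : R), 1]%classic.
Proof.
apply/mem_set; rewrite /= in_itv/= /clamp.
by case: (ltP x 1) => h1; case: (ltP 0 _) => h2; apply/andP; split; lra.
Qed.

Definition to_I (x : R) : unit_interval := exist _ (clamp x) (clamp_subproof x).

Definition of_I (t : unit_interval) : R := \val t.

Lemma of_I01 t : 0 <= of_I t <= 1.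
Proof. by have /set_mem := valP t; rewrite /= in_itv. Qed.

Lemma to_IK x : 0 <= x <= 1 -> of_I (to_I x) = x.
Proof.
move=> /andP[x0 x1]; rewrite /of_I /= /clamp.
by rewrite (min_idPl x1) (max_idPr x0).
Qed.

Lemma of_IK : cancel of_I to_I.
Proof. by move=> t; apply: val_inj; exact/to_IK/of_I01. Qed.

Lemma to_I_le0 x : x <= 0 -> to_I x = to_I 0.
Proof.
move=> x0; apply: val_inj => /=; rewrite /clamp.
rewrite (min_idPl (le_trans x0 ler01)) (min_idPl ler01).
by rewrite (max_idPl x0) (max_idPl (lexx 0)).
Qed.

Lemma to_I_ge1 x : 1 <= x -> to_I x = to_I 1.
Proof.
move=> x1; apply: val_inj => /=; rewrite /clamp.
by rewrite (min_idPr x1) (min_idPr (lexx 1)).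
Qed.

Lemma to_I01 : to_I 0 != to_I 1.
Proof.
by apply/eqP => /(congr1 of_I); rewrite !to_IK ?lexx ?ler01// => /eqP;
  rewrite eq_sym oner_eq0.
Qed.

HB.instance Definition _ := @isBiPointed.Build unit_interval _ _ to_I01.

Lemma of_I0 : of_I zero = 0. Proof. by rewrite to_IK// lexx ler01. Qed.
Lemma of_I1 : of_I one = 1. Proof. by rewrite to_IK// lexx ler01. Qed.

Lemma of_I_continuous : continuous of_I.
Proof. exact: initial_continuous. Qed.

Lemma to_I_continuous : continuous to_I.
Proof.
move=> x; apply: continuous_comp_initial => {}x.
apply: (@continuous_max R R (cst 0) (fun x => Num.min x 1) x).
  exact: cst_continuous.
apply: (@continuous_min R R id (cst 1) x) => //.
exact: cst_continuous.
Qed.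

End unit_interval.
Arguments unit_interval R : clear implicits.

Lemma continuous_paste {R : realType} {T U : topologicalType}
    (c : T -> R) (a : R) (f g : T -> U) :
  continuous c -> continuous f -> continuous g ->
  (forall t, c t = a -> f t = g t) ->
  continuous (fun t => if c t <= a then f t else g t).
Proof.
move=> cc cf cg fg t; rewrite /continuous_at.
have [cta|cta|cta] := ltgtP (c t) a.
- rewrite /= => A /cf fA; have cn : \forall s \near t, c s < a.
    exact: (cvgr_lt (c t) (cc t)).
  by apply: filterS2 cn fA => s csa fs /=; rewrite (ltW csa).
- rewrite /= => A /cg fA; have cn : \forall s \near t, a < c s.
    exact: (cvgr_gt (c t) (cc t)).
  by apply: filterS2 cn fA => s csa fs /=; rewrite leNgt csa.
- rewrite /= => A fA; have gA : nbhs (g t) A by rewrite -fg.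
  have fn : \forall s \near t, A (f s) by exact: cf.
  have gn : \forall s \near t, A (g s) by exact: cg.
  by apply: filterS2 fn gn => s fs gs /=; case: ifP.
Qed.

Lemma continuous_compose {T U V : topologicalType} (f : T -> U) (g : U -> V) :
  continuous f -> continuous g -> continuous (fun t => g (f t)).
Proof. by move=> cf cg t; exact: (continuous_comp (cf t) (cg (f t))). Qed.

Lemma continuous_pair {T U V : topologicalType} (f : T -> U) (g : T -> V) :
  continuous f -> continuous g -> continuous (fun t => (f t, g t)).
Proof. by move=> cf cg t; apply: cvg_pair; [exact: cf|exact: cg]. Qed.

Lemma continuous_fst {T U : topologicalType} :
  continuous (fun u : T * U => u.1).
Proof. by move=> u; exact: cvg_fst. Qed.

Lemma continuous_snd {T U : topologicalType} :
  continuous (fun u : T * U => u.2).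
Proof. by move=> u; exact: cvg_snd. Qed.

Lemma continuous_affine {R : realType} {T : topologicalType} (c : T -> R)
    (a b : R) :
  continuous c -> continuous (fun t => a * c t + b).
Proof.
move=> cc t; apply: (@cvgD R R T); last exact: cvg_cst.
by apply: cvgM; [exact: cvg_cst|exact: cc].
Qed.

Lemma continuous_mid {R : realType} {T : topologicalType} (c d s : T -> R) :
  continuous c -> continuous d -> continuous s ->
  continuous (fun t => c t + s t * (d t - c t)).
Proof.
move=> cc cd cs t; apply: (@cvgD R R T); first exact: cc.
by apply: cvgM; [exact: cs|apply: cvgB; [exact: cd|exact: cc]].
Qed.

Section path_operations.
Context {R : realType} {X : topologicalType}.
Local Notation I := (unit_interval R).

Lemma path_continuous (x y : X) (p : {path I from x to y}) :
  continuous (p : I -> X).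
Proof. exact: cts_fun. Qed.

(* The clamps in to_I are inactive here: the arguments lie in [0, 1]. *)
Definition cat_fun (f g : I -> X) (t : I) : X :=
  if of_I t <= 2^-1 then f (to_I (2 * of_I t)) else g (to_I (2 * of_I t - 1)).

Definition rev_fun (f : I -> X) (t : I) : X := f (to_I (1 - of_I t)).

Lemma cat_fun_continuous (f g : I -> X) :
  continuous f -> continuous g -> f one = g zero -> continuous (cat_fun f g).
Proof.
move=> cf cg fg; apply: continuous_paste.
- exact: of_I_continuous.
- apply: continuous_compose cf; apply: continuous_compose to_I_continuous.
  under eq_fun do rewrite -[2 * _]addr0.
  exact/continuous_affine/of_I_continuous.
- apply: continuous_compose cg; apply: continuous_compose to_I_continuous.
  exact/continuous_affine/of_I_continuous.
- by move=> t /= ->; rewrite mulfV ?pnatr_eq0// subrr.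
Qed.

Section cat.
Context (x y z : X) (p : {path I from x to y}) (q : {path I from y to z}).

Lemma concat_path_continuous : continuous (cat_fun p q).
Proof.
apply: cat_fun_continuous; [exact: cts_fun..|].
by rewrite path_zero path_one.
Qed.

Lemma concat_path_zero : cat_fun p q zero = x.
Proof. by rewrite /cat_fun of_I0 invr_ge0 ler0n mulr0; exact: path_zero. Qed.

Lemma concat_path_one : cat_fun p q one = z.
Proof.
rewrite /cat_fun of_I1 ifF; last by apply/negbTE; rewrite -ltNge; lra.
by rewrite mulr1 (_ : 2 - 1 = 1); [exact: path_one|lra].
Qed.

Definition concat_path : {path I from x to z} :=
  mk_path concat_path_continuous concat_path_zero concat_path_one.

End cat.

Section rev.
Context (x y : X) (p : {path I from x to y}).

Lemma reverse_path_continuous : continuous (rev_fun p).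
Proof.
apply: (continuous_compose (g := p)); last exact: cts_fun.
apply: continuous_compose to_I_continuous.
under eq_fun do rewrite addrC -mulN1r.
exact/continuous_affine/of_I_continuous.
Qed.

Lemma reverse_path_zero : rev_fun p zero = y.
Proof. by rewrite /rev_fun of_I0 subr0; exact: path_one. Qed.

Lemma reverse_path_one : rev_fun p one = x.
Proof. by rewrite /rev_fun of_I1 subrr; exact: path_zero. Qed.

Definition reverse_path : {path I from y to x} :=
  mk_path reverse_path_continuous reverse_path_zero reverse_path_one.

End rev.

Definition cst_path (x : X) : {path I from x to x} := cst x.

(* Homotopy of paths relative to the endpoints. *)
Definition homotopic (x y : X) (p q : {path I from x to y}) : Prop :=
  exists H : I * I -> X,
    [/\ continuous H,
        forall t, H (t, zero) = p t, forall t, H (t, one) = q t,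
        forall s, H (zero, s) = x & forall s, H (one, s) = y].

End path_operations.
Arguments cst_path {R X} x.

Section homotopy_theory.
Context {R : realType} {X : topologicalType}.
Local Notation I := (unit_interval R).

Lemma to_I0 : to_I 0 = zero :> I. Proof. by []. Qed.
Lemma to_I1 : to_I 1 = one :> I. Proof. by []. Qed.

Lemma homotopic_reparam (x y : X) (f : I -> X) (a b : I -> R)
    (p q : {path I from x to y}) :
  continuous f -> continuous a -> continuous b ->
  a zero = b zero -> a one = b one ->
  p =1 (fun t => f (to_I (a t))) -> q =1 (fun t => f (to_I (b t))) ->
  homotopic p q.
Proof.
move=> cf ca cb ab0 ab1 pE qE.
exists (fun u => f (to_I (a u.1 + of_I u.2 * (b u.1 - a u.1)))); split=> /=.
- apply: continuous_compose cf; apply: continuous_compose to_I_continuous.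
  have c1 : continuous (fun u : I * I => u.1) := continuous_fst.
  have c2 : continuous (fun u : I * I => u.2) := continuous_snd.
  apply: continuous_mid.
  + exact: continuous_compose c1 ca.
  + exact: continuous_compose c1 cb.
  + exact: continuous_compose c2 of_I_continuous.
- by move=> t; rewrite of_I0 mul0r addr0 pE.
- by move=> t; rewrite of_I1 mul1r addrC subrK qE.
- by move=> s; rewrite ab0 subrr mulr0 addr0 -qE; exact: path_zero.
- by move=> s; rewrite ab1 subrr mulr0 addr0 -qE; exact: path_one.
Qed.

Lemma homotopic_refl (x y : X) (p : {path I from x to y}) : homotopic p p.
Proof.
apply: (@homotopic_reparam _ _ p of_I of_I) => //.
- exact: cts_fun.
- exact: of_I_continuous.
- exact: of_I_continuous.
- by move=> t; rewrite of_IK.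
- by move=> t; rewrite of_IK.
Qed.

Lemma homotopic_sym (x y : X) (p q : {path I from x to y}) :
  homotopic p q -> homotopic q p.
Proof.
move=> [H [cH H0 H1 Hx Hy]].
exists (fun u => H (u.1, to_I (1 - of_I u.2))); split=> /=.
- apply: (continuous_compose (f := fun u : I * I => (u.1, to_I (1 - of_I u.2)))
    _ cH).
  have c2 : continuous (fun u : I * I => u.2) := continuous_snd.
  apply: continuous_pair; first exact: continuous_fst.
  apply: continuous_compose to_I_continuous.
  under eq_fun do rewrite addrC -mulN1r.
  apply: continuous_affine; exact: continuous_compose c2 of_I_continuous.
- by move=> t; rewrite of_I0 subr0.
- by move=> t; rewrite of_I1 subrr.
- by move=> s.
- by move=> s.
Qed.

Lemma homotopic_trans (x y : X) (p q r : {path I from x to y}) :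
  homotopic p q -> homotopic q r -> homotopic p r.
Proof.
move=> [H [cH H0 H1 Hx Hy]] [K [cK K0 K1 Kx Ky]].
have c1 : continuous (fun u : I * I => u.1) := continuous_fst.
have c2 : continuous (fun u : I * I => u.2) := continuous_snd.
have c2' := continuous_compose c2 of_I_continuous.
have cp (a b : R) : continuous (fun u : I * I => (u.1, to_I (a * of_I u.2 + b))).
  apply: continuous_pair; first exact: continuous_fst.
  by apply: continuous_compose to_I_continuous; exact: continuous_affine.
exists (fun u => if of_I u.2 <= 2^-1 then H (u.1, to_I (2 * of_I u.2 + 0))
                 else K (u.1, to_I (2 * of_I u.2 + -1))); split=> /=.
- apply: continuous_paste.
  + exact: c2'.
  + exact: continuous_compose (cp _ _) cH.
  + exact: continuous_compose (cp _ _) cK.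
  + by move=> [t s] /= ->; rewrite mulfV ?pnatr_eq0// addr0 subrr H1 K0.
- by move=> t; rewrite of_I0 invr_ge0 ler0n mulr0 addr0 H0.
- move=> t; rewrite of_I1 ifF; last by apply/negbTE; rewrite -ltNge; lra.
  by rewrite (_ : 2 * 1 + -1 = 1) ?K1//; lra.
- by move=> s; case: ifP.
- by move=> s; case: ifP.
Qed.

Lemma homotopic_cat (x y z : X) (p p' : {path I from x to y})
    (q q' : {path I from y to z}) :
  homotopic p p' -> homotopic q q' ->
  homotopic (concat_path p q) (concat_path p' q').
Proof.
move=> [H [cH H0 H1 Hx Hy]] [K [cK K0 K1 Kx Ky]].
have c1 : continuous (fun u : I * I => u.1) := continuous_fst.
have c2 : continuous (fun u : I * I => u.2) := continuous_snd.
have c1' := continuous_compose c1 of_I_continuous.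
have cp (a b : R) : continuous (fun u : I * I => (to_I (a * of_I u.1 + b), u.2)).
  apply: continuous_pair; last exact: continuous_snd.
  by apply: continuous_compose to_I_continuous; exact: continuous_affine.
exists (fun u => if of_I u.1 <= 2^-1 then H (to_I (2 * of_I u.1 + 0), u.2)
                 else K (to_I (2 * of_I u.1 + -1), u.2)); split=> /=.
- apply: continuous_paste.
  + exact: c1'.
  + exact: continuous_compose (cp _ _) cH.
  + exact: continuous_compose (cp _ _) cK.
  + by move=> [t s] /= ->; rewrite mulfV ?pnatr_eq0// addr0 subrr Hy Kx.
- by move=> t; rewrite H0 K0 addr0.
- by move=> t; rewrite H1 K1 addr0.
- by move=> s; rewrite of_I0 invr_ge0 ler0n mulr0 addr0 Hx.
- move=> s; rewrite of_I1 ifF; last by apply/negbTE; rewrite -ltNge; lra.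
  by rewrite (_ : 2 * 1 + -1 = 1) ?Ky//; lra.
Qed.

Lemma homotopic_rev (x y : X) (p q : {path I from x to y}) :
  homotopic p q -> homotopic (reverse_path p) (reverse_path q).
Proof.
move=> [H [cH H0 H1 Hx Hy]].
exists (fun u => H (to_I (1 - of_I u.1), u.2)); split=> /=.
- apply: (continuous_compose (f := fun u : I * I => (to_I (1 - of_I u.1), u.2))
    _ cH).
  have c1 : continuous (fun u : I * I => u.1) := continuous_fst.
  apply: continuous_pair; last exact: continuous_snd.
  apply: continuous_compose to_I_continuous.
  under eq_fun do rewrite addrC -mulN1r.
  apply: continuous_affine; exact: continuous_compose c1 of_I_continuous.
- by move=> t; rewrite H0.
- by move=> t; rewrite H1.
- by move=> s; rewrite of_I0 subr0 Hy.
- by move=> s; rewrite of_I1 subrr Hx.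
Qed.

Lemma reverse_pathK (x y : X) (p : {path I from x to y}) :
  reverse_path (reverse_path p) = p.
Proof.
apply/path_eqP => t; rewrite /= /mk_path/= /rev_fun /= /mk_path/= /rev_fun.
by rewrite to_IK ?subKr ?of_IK//; have := of_I01 t; lra.
Qed.

Lemma reverse_path_cat (x y z : X) (p : {path I from x to y})
    (q : {path I from y to z}) :
  reverse_path (concat_path p q) = concat_path (reverse_path q) (reverse_path p).
Proof.
apply/path_eqP => t; rewrite /= /mk_path/= /rev_fun /= /mk_path/= /cat_fun.
have t01 := of_I01 t; rewrite to_IK; last lra.
have [t2|t2] := leP (of_I t) 2^-1; last first.
  rewrite ifT; last lra.
  rewrite /rev_fun /= /mk_path/= /rev_fun to_IK; last lra.
  by congr (p (to_I _)); lra.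
rewrite /mk_path/= /rev_fun to_IK; last lra.
have [t3|t3] := leP (1 - of_I t) 2^-1; last by congr (q (to_I _)); lra.
have -> : of_I t = 2^-1 by lra.
rewrite (_ : 2 * (1 - 2^-1) = 1); last lra.
rewrite (_ : 1 - 2 * 2^-1 = 0); last lra.
by rewrite to_I0 to_I1 path_zero path_one.
Qed.

Lemma homotopic_catA (w x y z : X) (p : {path I from w to x})
    (q : {path I from x to y}) (r : {path I from y to z}) :
  homotopic (concat_path p (concat_path q r)) (concat_path (concat_path p q) r).
Proof.
pose a (t : I) : R :=
  Num.max (2^-1 * of_I t + 0) (Num.max (1 * of_I t + - 4^-1) (2 * of_I t + -1)).
have ca : continuous a.
  move=> t; apply: (@continuous_max R I); first exact/continuous_affine/of_I_continuous.
  by apply: (@continuous_max R I); exact/continuous_affine/of_I_continuous.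
apply: (@homotopic_reparam _ _ (concat_path (concat_path p q) r) a of_I) => //.
- exact: cts_fun.
- exact: of_I_continuous.
- by rewrite /a of_I0; case: (leP (1 * _ + _)) => ?; case: leP => ?; lra.
- by rewrite /a of_I1; case: (leP (1 * _ + _)) => ?; case: leP => ?; lra.
- move=> t; have t01 := of_I01 t.
  rewrite /= /mk_path/= /cat_fun /= /mk_path/= /cat_fun.
  have [t2|t2] := leP (of_I t) 2^-1.
    have -> : a t = 2^-1 * of_I t.
      by rewrite /a; case: (leP (1 * _ + _)) => ?; case: leP => ?; lra.
    rewrite to_IK; last lra.
    rewrite ifT; last lra.
    rewrite to_IK; last lra.
    rewrite ifT; last lra.
    by congr (p (to_I _)); lra.
  rewrite to_IK; last lra.
  have [t3|t3] := leP (2 * of_I t - 1) 2^-1.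
    have -> : a t = of_I t - 4^-1.
      by rewrite /a; case: (leP (1 * _ + _)) => ?; case: leP => ?; lra.
    rewrite to_IK; last lra.
    rewrite ifT; last lra.
    rewrite to_IK; last lra.
    rewrite ifF; last by apply/negbTE; rewrite -ltNge; lra.
    by congr (q (to_I _)); lra.
  have -> : a t = 2 * of_I t - 1.
    by rewrite /a; case: (leP (1 * _ + _)) => ?; case: leP => ?; lra.
  rewrite to_IK; last lra.
  rewrite ifF; last by apply/negbTE; rewrite -ltNge; lra.
  by congr (r (to_I _)); lra.
- by move=> t; rewrite of_IK.
Qed.

Lemma homotopic_cat1p (x y : X) (p : {path I from x to y}) :
  homotopic (concat_path (cst_path x) p) p.
Proof.
apply: (@homotopic_reparam _ _ p
  (fun t => Num.max 0 (2 * of_I t + -1)) of_I) => //.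
- exact: cts_fun.
- move=> t; apply: (@continuous_max R I (cst 0)); first exact: cst_continuous.
  exact/continuous_affine/of_I_continuous.
- exact: of_I_continuous.
- by rewrite of_I0; case: leP; lra.
- by rewrite of_I1; case: leP; lra.
- move=> t; rewrite /= /mk_path/= /cat_fun; case: leP => t2.
    rewrite max_l; last lra.
    by rewrite to_I0 path_zero.
  by rewrite max_r//; lra.
- by move=> t; rewrite of_IK.
Qed.

Lemma homotopic_catp1 (x y : X) (p : {path I from x to y}) :
  homotopic (concat_path p (cst_path y)) p.
Proof.
apply: (@homotopic_reparam _ _ p
  (fun t => Num.min (2 * of_I t + 0) 1) of_I) => //.
- exact: cts_fun.
- move=> t; apply: (@continuous_min R I _ (cst 1)); last exact: cst_continuous.
  exact/continuous_affine/of_I_continuous.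
- exact: of_I_continuous.
- by rewrite of_I0; case: leP; lra.
- by rewrite of_I1; case: leP; lra.
- move=> t; rewrite /= /mk_path/= /cat_fun; case: leP => t2.
    by rewrite min_l addr0//; lra.
  rewrite min_r; last lra.
  by rewrite to_I1 path_one.
- by move=> t; rewrite of_IK.
Qed.

Lemma homotopic_catpV (x y : X) (p : {path I from x to y}) :
  homotopic (concat_path p (reverse_path p)) (cst_path x).
Proof.
apply: (@homotopic_reparam _ _ p
  (fun t => Num.min (2 * of_I t + 0) (- 2 * of_I t + 2)) (cst 0)) => //.
- exact: cts_fun.
- by move=> t; apply: (@continuous_min R I);
    exact/continuous_affine/of_I_continuous.
- exact: cst_continuous.
- by rewrite of_I0 min_l /cst; lra.
- by rewrite of_I1 min_r /cst; lra.
- move=> t; have t01 := of_I01 t.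
  rewrite /= /mk_path/= /cat_fun; case: leP => t2.
    by rewrite min_l addr0//; lra.
  rewrite /= /mk_path/= /rev_fun to_IK; last lra.
  rewrite min_r; last lra.
  by congr (p (to_I _)); lra.
- by move=> t /=; rewrite to_I0 path_zero.
Qed.

Lemma homotopic_catVp (x y : X) (p : {path I from x to y}) :
  homotopic (concat_path (reverse_path p) p) (cst_path y).
Proof. by have := homotopic_catpV (reverse_path p); rewrite reverse_pathK. Qed.

End homotopy_theory.

Section path_class.
Context {R : realType} {X : topologicalType}.
Local Notation I := (unit_interval R).

Definition homotopic_rel (x y : X) : rel {path I from x to y} :=
  fun p q => `[< homotopic p q >].

Lemma homotopic_rel_refl x y : reflexive (@homotopic_rel x y).
Proof. by move=> p; apply/asboolP; exact: homotopic_refl. Qed.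

Lemma homotopic_rel_sym x y : symmetric (@homotopic_rel x y).
Proof. by move=> p q; apply/asbool_equiv_eq; split; exact: homotopic_sym. Qed.

Lemma homotopic_rel_trans x y : transitive (@homotopic_rel x y).
Proof.
by move=> q p r /asboolP pq /asboolP qr; apply/asboolP; exact: homotopic_trans qr.
Qed.

Canonical homotopic_equiv x y := EquivRel (@homotopic_rel x y)
  (@homotopic_rel_refl x y) (@homotopic_rel_sym x y) (@homotopic_rel_trans x y).

(* Homotopy classes of paths; the loops among them form the fundamental group
   pi1 below. *)
Definition path_class (x y : X) : Type := {eq_quot homotopic_equiv x y}.
HB.instance Definition _ x y := Choice.on (path_class x y).
HB.instance Definition _ x y := Quotient.on (path_class x y).

Definition pcls (x y : X) (p : {path I from x to y}) : path_class x y := \pi p.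

Lemma pclsP x y (p q : {path I from x to y}) :
  pcls p = pcls q <-> homotopic p q.
Proof.
split; first by move/eqquotP => /asboolP.
by move=> pq; apply/eqquotP/asboolP.
Qed.

Lemma repr_pcls x y (u : path_class x y) : pcls (repr u) = u.
Proof. exact: reprK. Qed.

Definition pc_cat x y z (u : path_class x y) (v : path_class y z) :
  path_class x z := pcls (concat_path (repr u) (repr v)).

Definition pc_rev x y (u : path_class x y) : path_class y x :=
  pcls (reverse_path (repr u)).

Lemma pcls_cat x y z (p : {path I from x to y}) (q : {path I from y to z}) :
  pcls (concat_path p q) = pc_cat (pcls p) (pcls q).
Proof. by apply/pclsP/homotopic_cat; apply/pclsP; rewrite repr_pcls. Qed.

Lemma pcls_rev x y (p : {path I from x to y}) :
  pcls (reverse_path p) = pc_rev (pcls p).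
Proof. by apply/pclsP/homotopic_rev; apply/pclsP; rewrite repr_pcls. Qed.

Lemma pc_catA w x y z (u : path_class w x) (v : path_class x y)
    (t : path_class y z) :
  pc_cat u (pc_cat v t) = pc_cat (pc_cat u v) t.
Proof.
rewrite -(repr_pcls u) -(repr_pcls v) -(repr_pcls t) -!pcls_cat.
exact/pclsP/homotopic_catA.
Qed.

Lemma pc_cat1p x y (u : path_class x y) : pc_cat (pcls (cst_path x)) u = u.
Proof. by rewrite -(repr_pcls u) -pcls_cat; exact/pclsP/homotopic_cat1p. Qed.

Lemma pc_catp1 x y (u : path_class x y) : pc_cat u (pcls (cst_path y)) = u.
Proof. by rewrite -(repr_pcls u) -pcls_cat; exact/pclsP/homotopic_catp1. Qed.

Lemma pc_catpV x y (u : path_class x y) :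
  pc_cat u (pc_rev u) = pcls (cst_path x).
Proof.
by rewrite -(repr_pcls u) -pcls_rev -pcls_cat; exact/pclsP/homotopic_catpV.
Qed.

Lemma pc_catVp x y (u : path_class x y) :
  pc_cat (pc_rev u) u = pcls (cst_path y).
Proof.
by rewrite -(repr_pcls u) -pcls_rev -pcls_cat; exact/pclsP/homotopic_catVp.
Qed.

Lemma pc_catKV x y z (u : path_class x y) (v : path_class y z) :
  pc_cat (pc_rev u) (pc_cat u v) = v.
Proof. by rewrite pc_catA pc_catVp pc_cat1p. Qed.

Lemma pc_catVK x y z (u : path_class y x) (v : path_class y z) :
  pc_cat u (pc_cat (pc_rev u) v) = v.
Proof. by rewrite pc_catA pc_catpV pc_cat1p. Qed.

Lemma pc_revK x y (u : path_class x y) : pc_rev (pc_rev u) = u.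
Proof. by rewrite -(repr_pcls u) -!pcls_rev reverse_pathK. Qed.

Lemma pc_rev_cat x y z (u : path_class x y) (v : path_class y z) :
  pc_rev (pc_cat u v) = pc_cat (pc_rev v) (pc_rev u).
Proof.
rewrite -(repr_pcls u) -(repr_pcls v) -pcls_cat -!pcls_rev -pcls_cat.
by rewrite reverse_path_cat.
Qed.

End path_class.

Definition pi1 (R : realType) (X : topologicalType) (x : X) : Type :=
  @path_class R X x x.
HB.instance Definition _ R X x := Choice.on (@pi1 R X x).
HB.instance Definition _ R X x := isGroup.Build (@pi1 R X x)
  (@pc_catA R X x x x x) (@pc_cat1p R X x x) (@pc_catp1 R X x x)
  (@pc_catVp R X x x) (@pc_catpV R X x x).
Arguments pi1 R {X} x.

Section subgroups.
Context {R : realType} {X : topologicalType}.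
Local Notation I := (unit_interval R).

Definition normal_subgroup (x : X) (H : groupClosed (pi1 R x)) : Prop :=
  forall g h : pi1 R x, h \in H -> (g^-1 * h * g)%g \in H.

(* The subgroup [l^-1 H l] of pi1 x. *)
Definition conj_pred (x0 x : X) (l : {path I from x0 to x})
    (H : groupClosed (pi1 R x0)) : {pred pi1 R x} :=
  fun c => `[< exists2 h : {path I from x0 to x0},
    (pcls h : pi1 R x0) \in H &
    c = pcls (concat_path (concat_path (reverse_path l) h) l) >].

Section conj_subgroup_closed.
Context (x0 x : X) (l : {path I from x0 to x}) (H : groupClosed (pi1 R x0)).

Lemma conj_subgroup1 : (1%g : pi1 R x) \in conj_pred l H.
Proof.
apply/asboolP; exists (cst_path x0); first exact: (@gpred1 _ H).
by rewrite !pcls_cat pcls_rev pc_catp1 pc_catVp.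
Qed.

Lemma conj_subgroupM : mulg_closed (conj_pred l H).
Proof.
move=> _ _ /asboolP[g gH ->] /asboolP[h hH ->]; apply/asboolP.
exists (concat_path g h); first by rewrite pcls_cat; exact: (@gpredM _ H _ _ gH hH).
by rewrite -[LHS]/(pc_cat _ _) !pcls_cat pcls_rev -!pc_catA pc_catVK.
Qed.

Lemma conj_subgroupV : invg_closed (conj_pred l H).
Proof.
move=> _ /asboolP[g gH ->]; apply/asboolP.
exists (reverse_path g); first by rewrite pcls_rev; exact: (@gpredVr _ H _ gH).
rewrite !pcls_cat !pcls_rev.
by rewrite -[LHS]/(pc_rev _) !pc_rev_cat pc_revK pc_catA.
Qed.

HB.instance Definition _ := isMulClosed.Build (pi1 R x) (conj_pred l H)
  conj_subgroupM.
HB.instance Definition _ := isMul1Closed.Build (pi1 R x) (conj_pred l H)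
  conj_subgroup1.
HB.instance Definition _ := isInvClosed.Build (pi1 R x) (conj_pred l H)
  conj_subgroupV.

Definition conj_subgroup : groupClosed (pi1 R x) := conj_pred l H.

End conj_subgroup_closed.
End subgroups.

Section path_space.
Context {R : realType} {X : topologicalType} (x : X).
Local Notation I := (unit_interval R).

(* Paths in X starting at x, topologized as a subspace of the compact-open
   topology on functions [0, 1] -> X. *)
Definition path_from : Type := set_type
  [set f : {compact-open, I -> X} | continuous (f : I -> X) /\ f zero = x].
HB.instance Definition _ := Topological.on path_from.

Definition path_fun (a : path_from) : I -> X := \val a.

Definition endpoint (a : path_from) : X := path_fun a one.

Lemma path_fun_continuous a : continuous (path_fun a).
Proof. by have /set_mem[] := valP a. Qed.

Lemma path_fun_zero a : path_fun a zero = x.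
Proof. by have /set_mem[] := valP a. Qed.

(* The path a, seen as a path with prescribed endpoint y = a(1). *)
Definition path_to (a : path_from) (y : X) (e : endpoint a = y) :
    {path I from x to y} :=
  mk_path (@path_fun_continuous a) (path_fun_zero a) e.

Definition path_of (a : path_from) : {path I from x to endpoint a} :=
  path_to (erefl (endpoint a)).

Lemma from_path_subproof y (p : {path I from x to y}) :
  (p : {compact-open, I -> X}) \in
    [set f : {compact-open, I -> X} | continuous (f : I -> X) /\ f zero = x].
Proof. by apply/mem_set; split; [exact: cts_fun|exact: path_zero]. Qed.

Definition from_path y (p : {path I from x to y}) : path_from :=
  exist _ (p : {compact-open, I -> X}) (from_path_subproof p).

HB.instance Definition _ := isPointed.Build path_from (from_path (cst_path x)).

Lemma endpoint_from_path y (p : {path I from x to y}) :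
  endpoint (from_path p) = y.
Proof. exact: path_one. Qed.

Lemma path_ofK a : from_path (path_of a) = a.
Proof. exact: val_inj. Qed.

Lemma path_toK a y (e : endpoint a = y) : from_path (path_to e) = a.
Proof. exact: val_inj. Qed.

Lemma from_pathK y (p : {path I from x to y})
  (e : endpoint (from_path p) = y) : path_to e = p.
Proof. exact/path_eqP. Qed.

End path_space.
Arguments path_from R {X} x.

Section coset_space.
Context {R : realType} {X : topologicalType} {x : X} (G : groupClosed (pi1 R x)).
Local Notation I := (unit_interval R).

(* The equation e : a(1) = b(1) is needed for a * b^-1 to be a loop. *)
Definition sim (a b : path_from R x) : Prop :=
  exists e : endpoint a = endpoint b,
    (pcls (concat_path (path_to e) (reverse_path (path_of b))) : pi1 R x) \in G.

Lemma sim_from_path y (p q : {path I from x to y}) :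
  sim (from_path p) (from_path q) <->
  (pcls (concat_path p (reverse_path q)) : pi1 R x) \in G.
Proof.
have E e : concat_path (@path_to R X x (from_path p) (endpoint (from_path q)) e)
    (reverse_path (path_of (from_path q))) = concat_path p (reverse_path q).
  exact/path_eqP.
split; first by move=> [e]; rewrite E.
move=> pq; have e : endpoint (from_path p) = endpoint (from_path q).
  by rewrite !endpoint_from_path.
by exists e; rewrite E.
Qed.

Lemma simP a b : sim a b -> exists y (p q : {path I from x to y}),
  [/\ a = from_path p, b = from_path q &
      (pcls (concat_path p (reverse_path q)) : pi1 R x) \in G].
Proof.
move=> [e pq]; exists (endpoint b), (path_to e), (path_of b).
by split=> //; rewrite ?path_toK ?path_ofK.
Qed.

Lemma sim_refl a : sim a a.
Proof.
rewrite -(path_ofK a); apply/sim_from_path.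
by rewrite pcls_cat pcls_rev pc_catpV; exact: (@gpred1 _ G).
Qed.

Lemma sim_sym a b : sim a b -> sim b a.
Proof.
move=> /simP[y [p [q [-> ->]]]] pq; apply/sim_from_path.
have := @gpredVr _ G _ pq; rewrite -[(_^-1)%g]/(pc_rev _).
by rewrite -pcls_rev reverse_path_cat reverse_pathK.
Qed.

Lemma sim_trans a b c : sim a b -> sim b c -> sim a c.
Proof.
move=> /simP[y [p [q [-> ->]]]] pq /simP[z [q' [r [E ->]]]].
have yz : y = z by rewrite -(endpoint_from_path q) E endpoint_from_path.
subst z; have <- : q = q'.
  by apply/path_eqP => t; move/(congr1 (fun a => path_fun a t)) : E.
move=> qr; apply/sim_from_path; have := @gpredM _ G _ _ pq qr.
rewrite -[(_ * _)%g]/(pc_cat _ _) !pcls_cat !pcls_rev -pc_catA.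
by rewrite (pc_catA (pc_rev _)) pc_catVp pc_cat1p.
Qed.

Definition sim_rel : rel (path_from R x) := fun a b => `[< sim a b >].

Lemma sim_rel_refl : reflexive sim_rel.
Proof. by move=> a; apply/asboolP; exact: sim_refl. Qed.

Lemma sim_rel_sym : symmetric sim_rel.
Proof. by move=> a b; apply/asbool_equiv_eq; split; exact: sim_sym. Qed.

Lemma sim_rel_trans : transitive sim_rel.
Proof.
by move=> b a c /asboolP ab /asboolP bc; apply/asboolP; exact: sim_trans bc.
Qed.

Canonical sim_equiv :=
  EquivRel sim_rel sim_rel_refl sim_rel_sym sim_rel_trans.

Definition tildeX : Type := {eq_quot sim_equiv}.
HB.instance Definition _ := Choice.on tildeX.
HB.instance Definition _ := Quotient.on tildeX.

Definition tcls (a : path_from R x) : tildeX := \pi a.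

Lemma tclsP a b : tcls a = tcls b <-> sim a b.
Proof.
split; first by move/eqquotP => /asboolP.
by move=> ab; apply/eqquotP/asboolP.
Qed.

Definition tildeX_top : Type := quotient_topology tildeX.
HB.instance Definition _ := Topological.on tildeX_top.

(* The set ([a]_G, U). *)
Definition whisker_nbhs (a : path_from R x) (U : set X) : set tildeX :=
  [set c | exists y (b : {path I from endpoint a to y}),
    (forall t, U (b t)) /\ c = tcls (from_path (concat_path (path_of a) b))].

Definition whisker_base (i : path_from R x * set X) : set tildeX :=
  whisker_nbhs i.1 i.2.

Definition whisker_index : set (path_from R x * set X) :=
  [set i | open i.2 /\ i.2 (endpoint i.1)].

Lemma tcls_cat y z (p q : {path I from x to y}) (r : {path I from y to z}) :
  tcls (from_path p) = tcls (from_path q) ->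
  tcls (from_path (concat_path p r)) = tcls (from_path (concat_path q r)).
Proof.
move=> /tclsP/sim_from_path pq; apply/tclsP/sim_from_path.
suff -> : pcls (concat_path (concat_path p r) (reverse_path (concat_path q r))) =
          pcls (concat_path p (reverse_path q)) by [].
by rewrite reverse_path_cat !pcls_cat !pcls_rev -!pc_catA pc_catVK.
Qed.

Lemma tcls_pcls y (p q : {path I from x to y}) :
  pcls p = pcls q -> tcls (from_path p) = tcls (from_path q).
Proof.
move=> pq; apply/tclsP/sim_from_path; rewrite pcls_cat pcls_rev pq pc_catpV.
exact: (@gpred1 _ G).
Qed.

Lemma tcls_catA w y z (p : {path I from x to w}) (q : {path I from w to y})
    (r : {path I from y to z}) :
  tcls (from_path (concat_path (concat_path p q) r)) =
  tcls (from_path (concat_path p (concat_path q r))).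
Proof. by apply: tcls_pcls; rewrite !pcls_cat pc_catA. Qed.

Lemma whisker_nbhs_refl a (U : set X) :
  U (endpoint a) -> whisker_nbhs a U (tcls a).
Proof.
move=> Ua; exists (endpoint a), (cst_path (endpoint a)); split=> //.
rewrite -[in LHS](path_ofK a); apply: tcls_pcls.
by rewrite pcls_cat pc_catp1.
Qed.

Lemma whisker_nbhs_sub a b (U V : set X) :
  whisker_nbhs a U (tcls b) -> V `<=` U ->
  whisker_nbhs b V `<=` whisker_nbhs a U.
Proof.
move=> [y [d [Ud /tclsP/simP[z [p [q [bp dq pq]]]]]]] VU.
have yz : y = z.
  by rewrite -(endpoint_from_path (concat_path (path_of a) d)) dq
    endpoint_from_path.
subst z; have qE : q = concat_path (path_of a) d.
  by apply/path_eqP => t; move/(congr1 (fun a => path_fun a t)) : dq.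
subst q b; move=> c [z [r [Vr ->]]].
have e : endpoint (from_path p) = y by exact: endpoint_from_path.
have -> : from_path (concat_path (path_of (from_path p)) r) =
    from_path (concat_path p
      (mk_path (@path_continuous _ _ _ _ r) (etrans path_zero e) path_one)) by exact: val_inj.
set r' := mk_path _ _ _.
exists z, (concat_path d r'); split.
  move=> t; rewrite /= /mk_path/= /cat_fun; case: ifP => _; first exact: Ud.
  exact/VU/Vr.
rewrite -tcls_catA; apply: tcls_cat.
exact/tclsP/sim_from_path.
Qed.

Lemma whisker_base_cover : \bigcup_(i in whisker_index) whisker_base i = setT.
Proof.
rewrite -subTset => c _; exists (repr c, setT).
  by split=> //; exact: openT.
by have := @whisker_nbhs_refl (repr c) setT Logic.I; rewrite /tcls reprK.
Qed.

Lemma whisker_nbhs_end a U b : whisker_nbhs a U (tcls b) -> U (endpoint b).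
Proof.
move=> [y [d [Ud /tclsP[e _]]]].
by rewrite e endpoint_from_path -(@path_one _ _ _ _ d).
Qed.

Lemma whisker_base_join i j c : whisker_index i -> whisker_index j ->
  whisker_base i c -> whisker_base j c ->
  exists k, [/\ whisker_index k, whisker_base k c &
                whisker_base k `<=` whisker_base i `&` whisker_base j].
Proof.
move: i j => [a U] [b V] [/= oU Ua] [/= oV Vb]; rewrite /whisker_base/=.
rewrite -[c]reprK -/(tcls _) => ca cb.
have UVc : (U `&` V) (endpoint (repr c)).
  by split; [exact: whisker_nbhs_end ca|exact: whisker_nbhs_end cb].
exists (repr c, U `&` V); split=> /=.
- by split=> //; exact: openI.
- exact: whisker_nbhs_refl.
- by rewrite subsetI; split; apply: whisker_nbhs_sub.
Qed.

(* A copy of tildeX carrying the whisker topology; its basis consists of the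
   sets ([a]_G, U) with U an open neighborhood of a(1). *)
Definition tildeX_wh : Type := tildeX.
HB.instance Definition _ := Choice.on tildeX_wh.
HB.instance Definition _ := isBaseTopological.Build tildeX_wh
  whisker_base_cover whisker_base_join.

Definition wh_topology : set_system tildeX := @open tildeX_wh.

Definition top_topology : set_system tildeX := @open tildeX_top.

End coset_space.
Arguments tcls {R X x} G a.
Arguments whisker_nbhs {R X x} G a U.
Arguments wh_topology {R X x} G _.
Arguments top_topology {R X x} G _.

Section SLT.
Context {R : realType} {X : topologicalType}.
Local Notation I := (unit_interval R).

Definition SLT_at (x : X) (G : groupClosed (pi1 R x)) : Prop :=
  forall (y : X) (a : {path I from x to y}) (U : set X), open U -> U x ->
  exists V : set X, [/\ open V, V y &
    forall b : {path I from y to y}, (forall t, V (b t)) ->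
    exists2 c : {path I from x to x}, (forall t, U (c t)) &
      tcls G (from_path (concat_path (concat_path a b) (reverse_path a))) =
      tcls G (from_path c)].

Definition SLT_space (x0 : X) (H : groupClosed (pi1 R x0)) : Prop :=
  forall (x : X) (l : {path I from x0 to x}), SLT_at (conj_subgroup l H).

End SLT.

Definition path_connected_in (R : realType) (X : topologicalType)
    (A : set X) : Prop :=
  forall x y, A x -> A y ->
  exists p : {path unit_interval R from x to y}, forall t, A (p t).

Definition locally_path_connected (R : realType) (X : topologicalType) : Prop :=
  forall (x : X) (U : set X), open U -> U x ->
  exists V : set X, [/\ open V, V x, V `<=` U & path_connected_in R V].

(* Main.v *)
Require Import Defs.
From mathcomp Require Import all_boot all_order all_algebra.
From mathcomp Require Import all_classical all_reals topology normedtype.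
From mathcomp Require Import homotopy.
From mathcomp Require Import lra.

(** Write [G_x] for the subgroup [l^-1 H l] of [pi1 x]. A path [d] from [x] to
    [y] carries [G_y] to [G_x] by conjugation, so a congruence modulo [G_x]
    between loops at [x], such as the one in SLT, is the same as a congruence
    modulo [G_y] between their conjugates at [y].

    The quotient topology is contained in the whisker topology for every
    subgroup: a compact-open neighborhood of [a * cst] contains [a * b] as soon
    as [b] stays close to the endpoint of [a], because [b] only replaces a
    constant stretch ([open_path_from_freeze]). The same remark, applied to the
    constant stretch in [cst * a^-1], turns equality of the topologies into
    SLT: the whisker set of [a^-1] and [U] is then a neighborhood of [a^-1] in
    the quotient, hence contains [b * a^-1] for every small loop [b] at the end
    of [a], so that [b * a^-1] and [a^-1 * c] have the same class for some
    loop [c] in [U]; this is [wh_sub_top_SLT].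

    The substance is the converse: under SLT, every path [e] close enough to
    [d] in the compact-open topology has the class of [d * c] for some path [c]
    in a given neighborhood [U] of [y = d(1)]. Joining [d(s)] to [e(s)] by a
    short path [r_s] at finitely many times [s] writes [e], up to homotopy and
    up to [r_1], as a product of lassos (go along [d] to time [s], run through
    the small loop bounded by [r_s], [r_s'] and the arcs of [e] and [d] between
    these times, and come back) followed by [d]. SLT along the reverse of [d],
    from [y] to [d(s)], slides each small loop to a loop in [U] at [y], modulo
    [G_y]. Normality of [H] makes it possible to collect all the error terms in
    [G_x], whatever stands to their left. The subdivision is replaced by
    induction along [0, 1] ([segment_ind]): the statement [follows_upto s] says
    that this works for the part of [e] before time [s], and
    [follows_upto_step] adds one lasso. *)

Set Implicit Arguments.
Unset Strict Implicit.
Unset Printing Implicit Defensive.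

Import Order.TTheory GRing.Theory Num.Theory.
Import numFieldNormedType.Exports.

Local Open Scope classical_set_scope.
Local Open Scope ring_scope.

Local Notation "u ** v" := (pc_cat u v) (at level 40, left associativity).
Local Notation "u ^~" := (pc_rev u) (at level 2, format "u ^~").

(** * Induction along the unit segment *)

(** The supremum of the points reached from [0] is reached, and would be passed
    if it were smaller than [1]. This stands in for a subdivision of [0, 1]
    subordinate to a cover. *)
Lemma segment_ind {R : realType} (P : R -> Prop) :
  P 0 ->
  (forall t, 0 <= t <= 1 -> exists2 e, 0 < e &
    forall s s', 0 <= s -> s <= s' -> s' <= 1 ->
      `|t - s| < e -> `|t - s'| < e -> P s -> P s') ->
  P 1.
Proof.
move=> P0 Pstep; pose A := [set s : R | 0 <= s <= 1 /\ P s].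
have A0 : A 0 by split=> //; rewrite lexx ler01.
have hA : has_sup A by split; [exists 0|exists 1 => s [/andP[]]].
have supA1 : sup A <= 1 by apply: ge_sup => [|s [/andP[]//]]; exists 0.
have supA0 : 0 <= sup A := ub_le_sup hA.2 A0.
have [|e e0 step] := Pstep (sup A); first by rewrite supA0.
have [s [/andP[s0 s1] Ps] es] := sup_adherent e0 hA.
have ssup : s <= sup A by apply: ub_le_sup; [exact: hA.2|split; rewrite ?s0].
pose s' := Num.min 1 (sup A + e / 2).
have s'1 : s' <= 1 by rewrite /s' ge_min lexx.
have s's : sup A <= s' by rewrite /s' le_min supA1/=; lra.
have s'e : s' <= sup A + e / 2 by rewrite /s' ge_min lexx orbT.
have Ps' : P s'.
  by apply: (step s) => //; [lra|rewrite ltr_norml; lra|rewrite ltr_norml; lra].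
have : s' <= sup A.
  by apply: ub_le_sup; [exact: hA.2|split=> //; rewrite s'1 andbT; lra].
rewrite /s'; case: (leP 1 (sup A + e / 2)) => [h _|]; last by lra.
by move: Ps'; rewrite /s' min_l.
Qed.

(** * Paths inside a set, and arcs of a path *)

Section path_image.
Context {R : realType} {X : topologicalType} (V : set X).
Local Notation I := (unit_interval R).

Lemma concat_path_in (x y z : X) (p : {path I from x to y})
    (q : {path I from y to z}) :
  (forall u, V (p u)) -> (forall u, V (q u)) -> forall u, V (concat_path p q u).
Proof. by move=> Vp Vq u; rewrite /= /mk_path/= /cat_fun; case: ifP. Qed.

Lemma reverse_path_in (x y : X) (p : {path I from x to y}) :
  (forall u, V (p u)) -> forall u, V (reverse_path p u).
Proof. by move=> Vp u; exact: Vp. Qed.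

End path_image.

Section subpath.
Context {R : realType} {X : topologicalType}.
Local Notation I := (unit_interval R).
Context (x y : X) (p : {path I from x to y}).

Definition subpath_fun (s t : R) (u : I) : X :=
  p (to_I (s + of_I u * (t - s))).

Lemma subpath_continuous s t : continuous (subpath_fun s t).
Proof.
apply: (continuous_compose (g := p)); last exact: cts_fun.
apply: continuous_compose to_I_continuous.
under eq_fun do rewrite addrC mulrC.
exact/continuous_affine/of_I_continuous.
Qed.

Section ends.
Context (s t : R) (a b : X) (ea : p (to_I s) = a) (eb : p (to_I t) = b).

Lemma subpath_zero : subpath_fun s t zero = a.
Proof. by rewrite /subpath_fun of_I0 mul0r addr0. Qed.

Lemma subpath_one : subpath_fun s t one = b.
Proof. by rewrite /subpath_fun of_I1 mul1r addrC subrK. Qed.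

(** The end points are free up to an equation, so that arcs of different paths
    and the paths joining them compose without transport. Times may run
    backwards, and outside [0, 1] the path is extended by constants. *)
Definition subpath : {path I from a to b} :=
  mk_path (@subpath_continuous s t) subpath_zero subpath_one.

Lemma subpath_in (V : set X) (c d : R) :
  (forall u, c <= u <= d -> V (p (to_I u))) ->
  c <= s <= d -> c <= t <= d -> forall u, V (subpath u).
Proof.
move=> pV cs ct u; apply: pV; have := of_I01 u.
by move: (of_I u) => v v01; nra.
Qed.

End ends.

Lemma subpath_cat (r s t : R) (a b c : X) (ea : p (to_I r) = a)
    (eb eb' : p (to_I s) = b) (ec : p (to_I t) = c) :
  pcls (subpath ea eb) ** pcls (subpath eb' ec) = pcls (subpath ea ec).
Proof.
rewrite -pcls_cat; apply/pclsP.
pose f (u : I) : R := if of_I u <= 2^-1 then 2 * (s - r) * of_I u + r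
  else 2 * (t - s) * of_I u + (s - (t - s)).
apply: (@homotopic_reparam _ _ _ _ p f (fun u => (t - r) * of_I u + r)) => //.
- exact: cts_fun.
- apply: continuous_paste; [exact: of_I_continuous|
    exact/continuous_affine/of_I_continuous|
    exact/continuous_affine/of_I_continuous|].
  by move=> u ->; lra.
- exact/continuous_affine/of_I_continuous.
- by rewrite /f of_I0 ifT; lra.
- by rewrite /f of_I1 ifF; [lra|apply/negbTE; rewrite -ltNge; lra].
- move=> u; have u01 := of_I01 u.
  rewrite /= /mk_path/= /cat_fun /f /mk_path/= /subpath_fun.
  by case: leP => u2; (rewrite to_IK; last lra); congr (p (to_I _)); lra.
- by move=> u; rewrite /= /mk_path/= /subpath_fun; congr (p (to_I _)); lra.
Qed.

Lemma subpath_refl (s : R) (a : X) (ea ea' : p (to_I s) = a) :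
  subpath ea ea' = cst_path a.
Proof.
by apply/path_eqP => u; rewrite /= /mk_path/= /subpath_fun subrr mulr0 addr0.
Qed.

Lemma subpath01 (ex : p (to_I 0) = x) (ey : p (to_I 1) = y) :
  subpath ex ey = p.
Proof.
apply/path_eqP => u; rewrite /= /mk_path/= /subpath_fun.
by rewrite add0r subr0 mulr1 of_IK.
Qed.

Lemma subpath_rev (s t : R) (a b : X) (ea ea' : p (to_I s) = a)
    (eb eb' : p (to_I t) = b) :
  (pcls (subpath ea eb))^~ = pcls (subpath eb' ea').
Proof.
by rewrite -[RHS](pc_catKV (pcls (subpath ea eb))) subpath_cat subpath_refl
  pc_catp1.
Qed.

End subpath.

(** * Classes of paths and the two topologies *)

Section classes.
Context {R : realType} {X : topologicalType}.
Local Notation I := (unit_interval R).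

Lemma tcls_eqP (x y : X) (G : groupClosed (pi1 R x))
    (p q : {path I from x to y}) :
  tcls G (from_path p) = tcls G (from_path q) <->
  (pcls p ** (pcls q)^~ : pi1 R x) \in G.
Proof. by rewrite tclsP sim_from_path pcls_cat pcls_rev. Qed.

(** Membership in a whisker set becomes a condition in the fundamental groupoid,
    for paths with arbitrary end points in place of elements of the path space.
*)
Lemma whiskerP (x y z : X) (G : groupClosed (pi1 R x)) (U : set X)
    (p : {path I from x to y}) (q : {path I from x to z}) :
  whisker_nbhs G (from_path p) U (tcls G (from_path q)) <->
  exists2 b : {path I from y to z}, (forall t, U (b t)) &
    (pcls q ** (pcls p ** pcls b)^~ : pi1 R x) \in G.
Proof.
have e : endpoint (from_path p) = y := endpoint_from_path p.
split=> [[w [b [Ub bq]]]|[b Ub bq]].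
- have zw : z = w.
    by move/tclsP : bq => [+ _]; rewrite !endpoint_from_path.
  subst w; exists (mk_path (@path_continuous _ _ _ _ b)
    (etrans path_zero e) path_one); first exact: Ub.
  rewrite -pcls_cat; apply/tcls_eqP; rewrite bq; congr tcls; exact: val_inj.
- exists z, (mk_path (@path_continuous _ _ _ _ b)
    (etrans path_zero (esym e)) path_one); split; first exact: Ub.
  move: bq; rewrite -pcls_cat => /tcls_eqP ->; congr tcls; exact: val_inj.
Qed.

(** A basic whisker set that contains the class of [a] contains the whisker set
    of [a] itself with the same [U], so only whiskers attached to [a] matter. *)
Lemma wh_topologyP (x : X) (G : groupClosed (pi1 R x)) (S : set (tildeX G)) :
  wh_topology G S <-> forall a : path_from R x, S (tcls G a) ->
    exists V, [/\ open V, V (endpoint a) & whisker_nbhs G a V `<=` S].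
Proof.
split.
- move=> [D DW <-] a [i Di ia]; have [oi _] := DW _ Di.
  have iea := whisker_nbhs_end ia.
  exists i.2; split=> // c ac; exists i => //.
  exact: (whisker_nbhs_sub ia) ac.
- move=> aS; exists [set i : path_from R x * set X |
        whisker_index i /\ @whisker_base R X x G i `<=` S].
    by move=> i [].
  rewrite eqEsubset; split=> [c [i [_ iS] /iS//]|c].
  rewrite -[c]reprK -/(tcls G _) => Sc; have [V [oV Va VS]] := aS _ Sc.
  by exists (repr c, V) => //; exact: whisker_nbhs_refl.
Qed.

Lemma whisker_nbhs_open (x : X) (G : groupClosed (pi1 R x)) a (U : set X) :
  open U -> wh_topology G (whisker_nbhs G a U).
Proof.
move=> oU; apply/wh_topologyP => b ab; exists U; split=> //.
  exact: whisker_nbhs_end ab.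
exact: whisker_nbhs_sub ab _.
Qed.

Lemma top_topologyP (x : X) (G : groupClosed (pi1 R x)) (S : set (tildeX G)) :
  top_topology G S <-> open (tcls G @^-1` S : set (path_from R x)).
Proof. by []. Qed.

End classes.

(** * Neighborhoods in the path space *)

Section compact_open.
Context {R : realType} {X : topologicalType} (x : X).
Local Notation I := (unit_interval R).

Lemma open_path_from (K : set I) (O : set X) : compact K -> open O ->
  open ([set a | path_fun a @` K `<=` O] : set (path_from R x)).
Proof.
move=> cK oO.
exists [set f : {compact-open, I -> X} | f @` K `<=` O] => //.
exact: compact_open_open.
Qed.

(** A subbasic condition on [a], mapping a compact set [K] into an open set [O],
    either says nothing about [D] or forces [z] to lie in [O]. In the latter
    case it survives any change of [a] on [D] with values in [O]; hence the
    paths equal to [a] off [D] converge to [a] when their values on [D] tend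
    to [z], whatever [D] is. *)
Lemma open_path_from_freeze (W : set (path_from R x)) (D : set I)
    (a : path_from R x) (z : X) :
  open W -> W a -> (forall t, D t -> path_fun a t = z) ->
  exists V, [/\ open V, V z & forall b : path_from R x,
    (forall t, D t -> V (path_fun b t)) ->
    (forall t, ~ D t -> path_fun b t = path_fun a t) -> W b].
Proof.
move=> [W' oW' <-] W'a Dz.
pose F : set_system {compact-open, I -> X} := filter_from (open_nbhs z)
  (fun V => [set f | (forall t, D t -> V (f t)) /\
                     (forall t, ~ D t -> f t = path_fun a t)]).
have FF : Filter F.
  apply: filter_from_filter; first by exists setT; split=> //; exact: openT.
  move=> V V' [oV Vz] [oV' V'z]; exists (V `&` V').
    by split; [exact: openI|].
  by move=> f [fV fa]; split; split=> // t Dt; have [] := fV t Dt.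
have Fa : F --> (path_fun a : {compact-open, I -> X}).
  apply/compact_open_cvgP => K O _ oO aKO.
  have [[t [Kt Dt]]|KD] := pselect (exists t, K t /\ D t).
  - exists O; first by split=> //; rewrite -(Dz t)//; apply: aKO; exists t.
    move=> f [fO fa] _ [u Ku <-]; have [Du|nDu] := pselect (D u).
      exact: fO.
    by rewrite fa//; apply: aKO; exists u.
  - exists setT; first by split=> //; exact: openT.
    move=> f [_ fa] _ [u Ku <-]; rewrite fa; first by apply: aKO; exists u.
    by move=> Du; apply: KD; exists u.
have [V [oV Vz] VW] : F W' by apply: Fa; exact: open_nbhs_nbhs.
by exists V; split=> // b bV ba; exact: VW.
Qed.

End compact_open.

(** * Conjugates of the subgroup *)

Section conjugates.
Context {R : realType} {X : topologicalType} (x0 : X).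
Context (H : groupClosed (pi1 R x0)).
Local Notation I := (unit_interval R).

Lemma conj_subgroupP (x : X) (l : {path I from x0 to x}) (u : pi1 R x) :
  u \in conj_subgroup l H <->
  (pcls l ** u ** (pcls l)^~ : pi1 R x0) \in H.
Proof.
split.
  move=> /asboolP[h hH ->].
  rewrite !pcls_cat pcls_rev -!pc_catA pc_catVK pc_catpV pc_catp1.
  exact: hH.
move=> uH; apply/asboolP; exists (repr (pcls l ** u ** (pcls l)^~)).
  by rewrite repr_pcls.
rewrite !pcls_cat pcls_rev repr_pcls -!pc_catA pc_catVp pc_catp1.
by rewrite pc_catKV.
Qed.

(** Change of base point along [d] between the subgroups [G_x] and [G_y]. *)
Lemma conj_subgroup_cat (x y : X) (l : {path I from x0 to x})
    (d : {path I from x to y}) (u : pi1 R y) :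
  u \in conj_subgroup (concat_path l d) H <->
  (pcls d ** u ** (pcls d)^~ : pi1 R x) \in conj_subgroup l H.
Proof. by rewrite !conj_subgroupP pcls_cat pc_rev_cat !pc_catA. Qed.

(** Conjugation by [l] turns a loop [v] at [x] into a loop at [x0], so that
    normality passes from [H] to its conjugates. *)
Lemma conj_subgroup_normal (x : X) (l : {path I from x0 to x})
    (u v : pi1 R x) : normal_subgroup H -> u \in conj_subgroup l H ->
  (v ** u ** v^~ : pi1 R x) \in conj_subgroup l H.
Proof.
move=> nH; rewrite !conj_subgroupP => /(nH (pcls l ** v^~ ** (pcls l)^~)).
set w := (_ * _ * _)%g; set w' := (X in _ -> X \in _); suff -> : w = w' by [].
rewrite /w /w' -[LHS]/(_ ** _ ** _) -[(_^-1)%g]/(pc_rev _).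
by rewrite !pc_rev_cat !pc_revK -!pc_catA !pc_catKV.
Qed.

End conjugates.

(** * Comparison of the two topologies *)

Section whisker_quotient.
Context {R : realType} {X : topologicalType} (x0 : X).
Context (H : groupClosed (pi1 R x0)).
Local Notation I := (unit_interval R).

(** A class [a] is also the class of [a * cst], and whiskers of [a] are obtained
    by perturbing the constant half of that path. *)
Lemma top_sub_wh (x : X) (G : groupClosed (pi1 R x)) :
  top_topology G `<=` wh_topology G.
Proof.
move=> S /top_topologyP oS; apply/wh_topologyP => a Sa.
pose a1 := from_path (concat_path (path_of a) (cst_path (endpoint a))).
have Sa1 : (tcls G @^-1` S) a1.
  rewrite /= (_ : tcls G a1 = tcls G a)// -[in RHS](path_ofK a).
  by apply: tcls_pcls; rewrite pcls_cat pc_catp1.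
have [|V [oV Va VS]] :=
  open_path_from_freeze (D := [set t | 2^-1 < of_I t]) (z := endpoint a) oS Sa1.
  by move=> t /= t2; rewrite /path_fun/= /mk_path/= /cat_fun leNgt t2.
exists V; split=> // _ [y [b [Vb ->]]]; apply: VS => t /= t2.
  by rewrite /path_fun/= /mk_path/= /cat_fun leNgt t2; exact: Vb.
by move/negP : t2; rewrite -leNgt /path_fun/= /mk_path/= /cat_fun => ->.
Qed.

(** Here the perturbed half is the first one: a small loop [b] at [y] turns
    [cst * a^-1] into [b * a^-1], which is thus equivalent, modulo the subgroup
    at [y], to [a^-1] followed by a loop in [U]. Conjugation by [a] moves this
    equivalence to [x]. *)
Lemma wh_sub_top_SLT :
  (forall (x : X) (l : {path I from x0 to x}),
    wh_topology (conj_subgroup l H) `<=` top_topology (conj_subgroup l H)) ->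
  SLT_space H.
Proof.
move=> wt x l y a U oU Ux; set a' := reverse_path a.
pose G := conj_subgroup (concat_path l a) H.
have /wt/top_topologyP oS := whisker_nbhs_open G (from_path a') oU.
have Sa : (tcls G @^-1` whisker_nbhs G (from_path a') U)
    (from_path (concat_path (cst_path y) a')).
  apply/whiskerP; exists (cst_path x) => //.
  by rewrite pcls_cat pc_cat1p pc_catp1 pc_catpV; exact: (@gpred1 _ G).
have [|V [oV Vy VS]] :=
  open_path_from_freeze (D := [set t | of_I t <= 2^-1]) (z := y) oS Sa.
  by move=> t /= t2; rewrite /path_fun/= /mk_path/= /cat_fun t2.
exists V; split=> // b Vb.
have /whiskerP[c Uc bc] : whisker_nbhs G (from_path a') U
    (tcls G (from_path (concat_path b a'))).
  apply: VS => t /= t2; rewrite /path_fun/= /mk_path/= /cat_fun.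
    by rewrite t2.
  by move/negP/negbTE : t2 => ->.
exists c => //; apply/tcls_eqP; move: bc => /conj_subgroup_cat.
by rewrite !pcls_cat !pcls_rev !pc_rev_cat pc_revK -!pc_catA pc_catpV pc_catp1.
Qed.

(** * Paths close to a given path *)

Section slt_to_open.
Hypotheses (lpc : locally_path_connected R X) (nH : normal_subgroup H)
  (slt : SLT_space H).
Context (x : X) (l : {path I from x0 to x}) (a : path_from R x).
Local Notation y := (endpoint a).
Local Notation d := (path_of a).
Context (U : set X) (oU : open U) (Uy : U y).
Local Notation G := (conj_subgroup l H).
Local Notation head e s :=
  (subpath (p := path_of e) (s := 0) (t := s) (path_fun_zero e) erefl).
Local Notation tail s := (subpath (p := d) (s := s) (t := 1) erefl erefl).

(** The path [r] is the short connection at time [s], and [c] collects the loops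
    in [U] to which the lassos before time [s] have been slid. The set [N] is
    quantified here, and not bound to [s], because the next step dictates how
    short [r] must be. *)
Definition follows_upto (s : R) : Prop :=
  forall N : set X, open N -> N (d (to_I s)) ->
  exists W : set (path_from R x), [/\ open W, W a & forall e, W e ->
    exists (r : {path I from d (to_I s) to path_of e (to_I s)})
           (c : {path I from y to y}),
      [/\ forall u, N (r u), forall u, U (c u) &
        (pcls (head e s) ** (pcls r)^~ ** pcls (tail s) ** (pcls c)^~
          ** (pcls d)^~ : pi1 R x) \in G]].

Lemma follows_upto0 : follows_upto 0.
Proof.
move=> N oN Nd; exists setT; split=> //; first exact: openT.
move=> e _.
have e0 : path_of e (to_I 0) = d (to_I 0).
  by rewrite !to_I0 !path_zero.
pose r := subpath (p := path_of e) (s := 0) (t := 0) e0 erefl.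
exists r, (cst_path y); split=> //.
  by move=> u; rewrite /= /mk_path/= /subpath_fun subrr mulr0 addr0 e0.
have dx : d (to_I 0) = x by rewrite to_I0 path_zero.
rewrite (subpath_rev _ e0 erefl erefl) subpath_cat.
have -> : subpath (p := path_of e) (path_fun_zero e) e0 =
    subpath (p := d) dx erefl.
  apply/path_eqP => u; rewrite /= /mk_path/= /subpath_fun subrr mulr0 addr0.
  by rewrite e0.
rewrite subpath_cat subpath01.
rewrite -(subpath_refl (p := d) (s := 1) erefl erefl) subpath_rev subpath_refl.
by rewrite pc_catp1 pc_catpV; exact: (@gpred1 _ G).
Qed.

(** One lasso: [V] is the neighborhood of [d(t)] that SLT provides for the path
    from [y] back to [d(t)] along [d]. For times [s] and [s'] near [t], the
    small loop through [r] and [r'] stays in [V], so it is slid into [U]. *)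
Lemma follows_upto_step (t : R) : exists2 e : R, 0 < e &
  forall s s', 0 <= s -> s <= s' -> s' <= 1 ->
    `|t - s| < e -> `|t - s'| < e -> follows_upto s -> follows_upto s'.
Proof.
pose st := subpath (p := d) (s := 1) (t := t) erefl erefl.
have [V [oV Vt VU]] := slt (concat_path l d) st oU Uy.
have : nbhs t (fun s => V (d (to_I s))).
  have cd : continuous (d \o to_I) :=
    continuous_compose to_I_continuous (@cts_fun _ _ d).
  exact: cd (open_nbhs_nbhs (conj oV Vt)).
move=> /nbhs_ballP[e /= e0 eV]; exists e => //.
move=> s s' s0 ss' s'1 ts ts' Ps N oN Ns'.
have dV u : s <= u <= s' -> V (d (to_I u)).
  move=> us; apply: eV; rewrite /ball/=.
  by move: ts ts'; rewrite !ltr_norml; lra.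
(* Local path connectedness supplies the next connection r', short enough both
   for the requested N and for the small loop to stay in V. *)
have [|N' [oN' N's' N'NV N'pc]] := lpc (openI oN oV) (x := d (to_I s')).
  by split=> //; apply: dV; rewrite ss' lexx.
have [|W [oW Wa WP]] := Ps V oV; first by apply: dV; rewrite ss' lexx.
pose K : set I := to_I @` `[s, s'].
have cK : compact K.
  apply: continuous_compact; last exact: segment_compact.
  exact/continuous_subspaceT/to_I_continuous.
pose W1 : set (path_from R x) := [set b | path_fun b @` K `<=` V].
pose W2 : set (path_from R x) := [set b | path_fun b @` [set to_I s'] `<=` N'].
exists (W `&` (W1 `&` W2)); split.
- apply: openI => //; apply: openI; apply: open_path_from => //.
  exact: compact_set1.
- split=> //; split.
    by move=> _ [_ [u /= us <-] <-]; apply: dV; move: us; rewrite in_itv.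
  by move=> _ [_ -> <-].
move=> b [/WP[r [c [Vr Uc rc]]] [bV bN]].
have bV' u : s <= u <= s' -> V (path_of b (to_I u)).
  move=> us; apply: bV; exists (to_I u) => //.
  by exists u => //=; rewrite in_itv.
have [r' N'r'] : exists r' : {path I from d (to_I s') to path_of b (to_I s')},
    forall u, N' (r' u).
  by apply: N'pc => //; apply: bN; exists (to_I s').
pose bs := subpath (p := path_of b) (s := s) (t := s') erefl erefl.
pose ds := subpath (p := d) (s := s') (t := s) erefl erefl.
pose dt := subpath (p := d) (s := t) (t := s) erefl erefl.
have Vdt u : V (dt u).
  apply: eV; rewrite /ball/=; have := of_I01 u.
  by move: ts; rewrite !ltr_norml; move: (of_I u) => v; nra.
pose lasso := concat_path (concat_path (concat_path (concat_path
  (concat_path dt r) bs) (reverse_path r')) ds) (reverse_path dt).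
have Vbs u : V (bs u).
  by apply: (subpath_in (p := path_of b) erefl erefl bV'); rewrite ?lexx ?ss'.
have Vds u : V (ds u).
  by apply: (subpath_in (p := d) erefl erefl dV); rewrite ?lexx ?ss'.
have Vr' u : V (r' u) by have [] := N'NV _ (N'r' u).
have Vlasso : forall u, V (lasso u).
  apply: concat_path_in; last exact: reverse_path_in.
  apply: concat_path_in; last by [].
  apply: concat_path_in; last exact: reverse_path_in.
  by apply: concat_path_in; first exact: concat_path_in.
have [c' Uc' /tcls_eqP/conj_subgroup_cat c'G] := VU lasso Vlasso.
exists r', (concat_path c c'); split.
- by move=> u; have [] := N'NV _ (N'r' u).
- exact: concat_path_in.
(* Between c and c' stands the error of sliding the lasso, an element of the
   subgroup at y. Moving it to the left of d c amounts to conjugating its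
   transport along d by the loop d c d^-1, and normality keeps the result in
   G; the product with the membership known at time s then telescopes. *)
have := @gpredM _ G _ _ rc
  (conj_subgroup_normal (pcls d ** pcls c ** (pcls d)^~) nH c'G).
set v := (_ * _)%g; set v' := (X in _ -> X \in _); suff -> : v = v' by [].
rewrite /v /v' -[LHS]/(_ ** _).
rewrite !pcls_cat !pcls_rev !pc_rev_cat !pc_revK -!pc_catA.
have dtE : pcls dt = (pcls st)^~ ** (pcls (tail s))^~.
  by rewrite !(subpath_rev _ _ erefl erefl) subpath_cat.
rewrite -(subpath_cat (p := path_of b) (s := s) (t := s')
  (path_fun_zero b) erefl erefl erefl).
rewrite -(subpath_cat (p := d) (r := s') (s := s) (t := 1)
  erefl erefl erefl erefl).
rewrite -/bs -/ds dtE !pc_rev_cat !pc_revK -!pc_catA.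
by rewrite !(pc_catKV, pc_catVK).
Qed.

(** At time [1] the connection [r] joins [d(1)] to [e(1)] inside [U], so [c * r]
    is a whisker that takes [d] to the class of [e]. *)
Lemma whisker_nbhs_top : exists W : set (path_from R x),
  [/\ open W, W a & W `<=` tcls G @^-1` whisker_nbhs G a U].
Proof.
have d1 : follows_upto 1 :=
  segment_ind follows_upto0 (fun t _ => follows_upto_step t).
have [W [oW Wa WP]] := d1 U oU Uy.
exists W; split=> // e /WP[r [c [Ur Uc rc]]].
rewrite /preimage/mkset -(path_ofK e) -{1}(path_ofK a); apply/whiskerP.
exists (concat_path c r); first exact: concat_path_in.
move: rc; rewrite !subpath01 subpath_refl pc_catp1 !pcls_cat !pc_rev_cat.
by rewrite -!pc_catA.
Qed.

End slt_to_open.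

Lemma SLT_wh_sub_top (x : X) (l : {path I from x0 to x}) :
  locally_path_connected R X -> normal_subgroup H -> SLT_space H ->
  wh_topology (conj_subgroup l H) `<=` top_topology (conj_subgroup l H).
Proof.
move=> lpc nH slt S /wh_topologyP whS; apply/top_topologyP.
rewrite openE => a /whS[U [oU Ua US]].
have [W [oW Wa WU]] := whisker_nbhs_top lpc nH slt l oU Ua.
by apply: filterS (open_nbhs_nbhs (conj oW Wa)) => e /WU /US.
Qed.

End whisker_quotient.

Theorem theorem3p1 (R : realType) (X : topologicalType) (x0 : X)
    (H : groupClosed (pi1 R x0)) :
  path_connected_in R [set: X] ->
  locally_path_connected R X ->
  normal_subgroup H ->
  SLT_space H <->
  (forall (x : X) (l : {path unit_interval R from x0 to x}),
    wh_topology (conj_subgroup l H) = top_topology (conj_subgroup l H)).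
Proof.
move=> _ lpc nH; split=> [slt x l|wt].
- by apply/seteqP; split; [exact: SLT_wh_sub_top|exact: top_sub_wh].
- by apply: wh_sub_top_SLT => x l; rewrite wt.
Qed.
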